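(* Let $k,N\ge1$ be integers, let $\lambda\vdash N$ be an integer partition, and for $1\le l\le N$ let $m_l$ be the multiplicity of $l$ in $\lambda$. Let $X_1,\dots,X_k$ be pairwise disjoint finite nonempty sets with $|X_i|=n_i$, let $\mathrm{EC}(\lambda)$ be the set of eventually $\lambda$-cyclic $k$-tuples $f=(f_1,\dots,f_k)$ of functions $f_i:X_i\to X_{i+1}$ (indices modulo $k$), and let $P_\lambda(\mathbf x)=\sum_{f\in\mathrm{EC}(\lambda)}w(f)$. Then $$P_\lambda(\mathbf x)=\frac{(N!)^k}{\prod_{l=1}^N l^{m_l}m_l!}\prod_{i=1}^k e_1(X_i)^{n_{i-1}-(N+1)}\left(\prod_{j=1}^k e_1(X_j)e_N(X_j)-(N+1)^k\prod_{j=1}^k e_{N+1}(X_j)\right),$$ and $$\#\mathrm{EC}(\lambda)=\frac1{\prod_{l=1}^N l^{m_l}m_l!}\prod_{i=1}^k n_i^{\,n_{i-1}-(N+1)}\frac{n_i!}{(n_i-N)!}\left(\prod_{j=1}^k n_j-\prod_{j=1}^k(n_j-N)\right).$$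
   Context: Indices are modulo $k$, so $X_{k+1}=X_1$ and $n_0=n_k$. A $k$-tuple $(f_1,\dots,f_k)$ with $f_i:X_i\to X_{i+1}$ is eventually $\lambda$-cyclic if the iterated images $(f_k\cdots f_1)^m(X_1)$ of the composition $f_k\cdots f_1:X_1\to X_1$ eventually stabilize (for large $m$) to a subset of $X_1$ of cardinality $N$ on which $f_k\cdots f_1$ acts as a permutation of cycle type $\lambda$, i.e. with exactly $m_l$ disjoint cycles of length $l$ for each $l\le N$. There is one commuting variable $x_v$ for each $v\in\bigsqcup_iX_i$; $w(f)=\prod_{i=1}^k\prod_{v\in X_i}x_{f_i(v)}$; and $e_j(U)=\sum_{S\subseteq U,\,|S|=j}\prod_{v\in S}x_v$ (zero if $j>|U|$). The quotient $n!/(n-N)!$ denotes the falling factorial $n(n-1)\cdots(n-N+1)$, which is $0$ when $n<N$. In the cardinality formula the product $\prod_{i=1}^k$ covers both factors $n_i^{n_{i-1}-(N+1)}$ and $n_i!/(n_i-N)!$, the final parenthesis being outside it. Negative exponents are read in the field of rational functions in the $x_v$ (respectively in $\mathbb Q$). *)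

(* Defs.v *)
From HB Require Import structures.
From mathcomp Require Import all_boot all_order all_fingroup all_algebra.
From mathcomp Require Export boolp.
From mathcomp.multinomials Require Export mpoly.

Set Implicit Arguments.
Unset Strict Implicit.
Unset Printing Implicit Defensive.

Import GRing.Theory.
Local Open Scope ring_scope.

Definition is_partition (N : nat) (la : seq nat) : bool :=
  [&& sorted geq la, 0%N \notin la & sumn la == N].

Definition acts_with_cycle_type (T : finType) (g : T -> T) (S : {set T})
    (la : seq nat) : Prop :=
  exists s : {perm {x : T | x \in S}},
    (forall x, val (s x) = g (val x)) /\
    (forall l : nat, (1 <= l <= #|S|)%N ->
       #|[set C in porbits s | #|C| == l]| = count_mem l la).

Definition eventually_cyclic_map (T : finType) (g : T -> T) (N : nat)
    (la : seq nat) : Prop :=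
  exists S : {set T},
    [/\ exists M : nat, forall m : nat, (M <= m)%N -> iter m g @: [set: T] = S,
        #|S| = N
      & acts_with_cycle_type g S la].

Lemma iter_ordS_val k (i : 'I_k) j : val (iter j (@ordS k) i) = ((i + j) %% k)%N.
Proof.
elim: j => [|j IHj]; first by rewrite addn0 modn_small.
by rewrite iterS /= IHj -addn1 modnDml addn1 addnS.
Qed.

Lemma iter_ordS k (i : 'I_k) : iter k (@ordS k) i = i.
Proof. by apply: val_inj; rewrite iter_ordS_val modnDr modn_small. Qed.

(* X_1, ..., X_k is the family [X] indexed by 0, ..., k-1; [ordS] and
   [ord_pred] are the cyclic successor and predecessor on 'I_k. *)
Definition maps (k : nat) (X : 'I_k -> finType) : finType :=
  {dffun forall i : 'I_k, {ffun X i -> X (ordS i)}}.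

(* f_{i+j-1} o ... o f_i : X_i -> X_{i+j}, indices modulo k *)
Fixpoint partial_comp (k : nat) (X : 'I_k -> finType) (f : maps X) (i : 'I_k)
    (j : nat) : X i -> X (iter j (@ordS k) i) :=
  if j is j'.+1 then
    fun x => f (iter j' (@ordS k) i) (partial_comp f j' x)
  else id.

Definition full_comp (k : nat) (X : 'I_k -> finType) (f : maps X) (i : 'I_k)
    (x : X i) : X i :=
  ecast j (X j) (iter_ordS i) (partial_comp f k x).

(* [Ordinal hk] is the index 0, so the composition is taken on X_1. *)
Definition EC (k : nat) (hk : (0 < k)%N) (X : 'I_k -> finType) (N : nat)
    (la : seq nat) : {set maps X} :=
  [set f : maps X |
    `[< eventually_cyclic_map (@full_comp k X f (Ordinal hk)) N la >]].

(* Pairwise disjointness of the X_i is built in: the x_v are indexed by the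
   disjoint union. *)
Definition dunion (k : nat) (X : 'I_k -> finType) : finType := {i : 'I_k & X i}.

Definition part (k : nat) (X : 'I_k -> finType) (i : 'I_k) : {set dunion X} :=
  [set v : dunion X | tag v == i].

Definition vpoly (V : finType) : idomainType := {mpoly rat[#|V|]}.

Definition var (V : finType) (v : V) : vpoly V :=
  ('X_(enum_rank v) : {mpoly rat[#|V|]}).

Definition elem_sym (V : finType) (j : nat) (U : {set V}) : vpoly V :=
  \sum_(S : {set V} | (S \subset U) && (#|S| == j)) \prod_(v in S) var v.

Definition weight (k : nat) (X : 'I_k -> finType) (f : maps X) :
    vpoly (dunion X) :=
  \prod_(i < k) \prod_(v : X i) var (Tagged X (f i v) : dunion X).

Definition Plambda (k : nat) (hk : (0 < k)%N) (X : 'I_k -> finType) (N : nat)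
    (la : seq nat) : vpoly (dunion X) :=
  \sum_(f in EC hk X N la) weight f.

Definition ratfun (V : finType) : fieldType := {fraction (vpoly V)}.

Definition elem_symF (V : finType) (j : nat) (U : {set V}) : ratfun V :=
  tofrac (elem_sym j U).

(* z_lambda = prod_l l^(m_l) m_l! *)
Definition zlambda (N : nat) (la : seq nat) : nat :=
  (\prod_(1 <= l < N.+1) (l ^ count_mem l la * (count_mem l la)`!))%N.

(* Main.v *)
(** Glue the [f_i] into one map of the disjoint union and split it at its set
    [S] of periodic points: a permutation of [S] and a forest rooted at [S].
    If [f] is eventually lambda-cyclic, [S] meets every block in [N] points, and
    [(N!)^k / z_lambda] permutations of [S] have the required type, each of
    weight the product of [x_v] over [S]. Forests are counted by a determinant:
    by multilinearity it is a sum over all maps off [S] of [det (1 - P_h)], which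
    is 1 for a forest and 0 otherwise. The matrix is a diagonal one minus one of
    rank at most [k], so the determinant reduces to a [k x k] one, and the
    forests have total weight, with [u_i] the sum of [x_v] over [X_i \ S],
      [prod_i e_1(X_i)^(n_(i-1) - N) * (1 - prod_i u_i / e_1(X_i))].
    Summing over [S] uses that the sum of [x^A * e_1(X_i \ A)] over the
    [N]-subsets [A] of [X_i] is [(N + 1) e_(N+1)(X_i)]. All this holds for
    arbitrary weights in a field with nonzero block sums; the cardinality is
    the case of weights 1 in [rat]. *)

Require Import Defs.
From HB Require Import structures.
From mathcomp Require Import all_boot all_order all_fingroup all_algebra.

Set Implicit Arguments.
Unset Strict Implicit.
Unset Printing Implicit Defensive.

Import GRing.Theory.
Local Open Scope ring_scope.

(** * Permutations of given cycle type *)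

Section CycleTypes.

Local Open Scope nat_scope.
Implicit Types (T : finType) (la : seq nat).

(** This is z_lambda: an entry [l] is weighted by its multiplicity counted from its own position on,
    so the equal entries together give [l^m * m!]. The recursion matches the removal of one cycle in
    [card_ctype]. *)
Fixpoint zprod la :=
  if la is l :: la' then l * (count_mem l la').+1 * zprod la' else 1.

Definition element_cycle_sizes la := flatten [seq nseq l l | l <- la].

Lemma count_element_cycle_sizes la l :
  count_mem l (element_cycle_sizes la) = l * count_mem l la.
Proof.
elim: la => [|a la IHla]; first by rewrite muln0.
rewrite /element_cycle_sizes /= count_cat IHla count_nseq mulnDr /=.
by case: (a =P l) => [->|_]; rewrite ?mul1n ?muln1 ?mul0n ?muln0.
Qed.

(** Cycle type is read off element by element: a cycle of length [l] shows up as [l] points of order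
    [l]. So [f] need not be given as a permutation of a subtype. *)
Definition has_ctype T (f : T -> T) (A : {set T}) la :=
  perm_eq [seq fingraph.order f x | x <- enum A] (element_cycle_sizes la).

(** The [g]-orbit of [x] stays in [A], where [i] intertwines [g] and [f]; hence [i] maps it
    bijectively onto the [f]-orbit of [i x]. *)
Lemma order_transport T T' (i : T -> T') (A : pred T) f g x :
  injective i -> {in A, forall x, i (g x) = f (i x)} ->
  {homo g : x / x \in A} -> x \in A -> fingraph.order f (i x) = fingraph.order g x.
Proof.
move=> inj_i ig gA xA.
have it n : i (iter n g x) = iter n f (i x) /\ iter n g x \in A.
  by elim: n => [|n [IHn nA]] //=; rewrite -IHn ig //; split=> //; apply: gA.
rewrite /fingraph.order -(card_image inj_i); apply: eq_card => y.
apply/idP/imageP => [|[z]]; rewrite !inE.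
  move/iter_findex=> <-; exists (iter (findex f (i x) y) g x).
    by rewrite inE fconnect_iter.
  by case: (it (findex f (i x) y)).
by move/iter_findex=> <- ->; case: (it (findex g x z)) => -> _; apply: fconnect_iter.
Qed.

Lemma eq_order_in T (f g : T -> T) (A : pred T) x :
  {in A, g =1 f} -> {homo g : x / x \in A} -> x \in A -> fingraph.order f x = fingraph.order g x.
Proof. exact: (@order_transport _ _ id). Qed.

Lemma perm_has_ctype T (f : T -> T) (A : {set T}) la s :
  uniq s -> s =i A ->
  has_ctype f A la = perm_eq [seq fingraph.order f x | x <- s] (element_cycle_sizes la).
Proof.
move=> Us sA; rewrite /has_ctype.
have /permPl-> // : perm_eq [seq fingraph.order f x | x <- enum A]
                            [seq fingraph.order f x | x <- s].
apply: perm_map; apply: uniq_perm => [||x]; rewrite ?enum_uniq //.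
by rewrite mem_enum sA.
Qed.

Lemma eq_has_ctype T (f g : T -> T) (A : {set T}) la :
  {in A, g =1 f} -> {homo g : x / x \in A} -> has_ctype f A la = has_ctype g A la.
Proof.
move=> pq pA; congr (perm_eq _ _); apply/eq_in_map => x.
by rewrite mem_enum => xA; rewrite (eq_order_in pq pA).
Qed.

Lemma card_size_ctype T (f : T -> T) (A : {set T}) la l :
  has_ctype f A la -> #|[set x in A | fingraph.order f x == l]| = l * count_mem l la.
Proof.
move=> /seq.permP/(_ (pred1 l)); rewrite count_element_cycle_sizes => <-.
rewrite count_map -size_filter -(card_uniqP (filter_uniq _ (enum_uniq _))).
by apply: eq_card => x; rewrite inE mem_filter mem_enum andbC.
Qed.

Lemma cycle_perm_exists T (w : seq T) :
  uniq w -> {p : {perm T} | p =1 next w}.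
Proof.
by move=> Uw; exists (perm (can_inj (prev_next Uw))) => x; rewrite permE.
Qed.

Lemma next_out (T : eqType) (w : seq T) x : x \notin w -> next w x = x.
Proof. by case: w => // y w; rewrite next_nth => /negPf->. Qed.

(** The points of [w] all have order [size w], so they account for exactly the first run of
    [element_cycle_sizes], which cancels. *)
Lemma has_ctype_cons T (f : T -> T) (A : {set T}) (w : seq T) la :
  uniq w -> {subset w <= A} -> fcycle f w ->
  has_ctype f A (size w :: la) = has_ctype f (A :\: [set x in w]) la.
Proof.
move=> Uw wA fw; set B := A :\: _.
rewrite (perm_has_ctype _ _ (s := w ++ enum B)); first last.
- move=> x; rewrite mem_cat mem_enum !inE.
  by case: (boolP (x \in w)) => // /wA ->.
- rewrite cat_uniq Uw enum_uniq andbT /=.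
  by apply/hasPn => x; rewrite mem_enum !inE => /andP[].
rewrite map_cat; have -> : [seq fingraph.order f x | x <- w] = nseq (size w) (size w).
  rewrite -{1}(size_map (fingraph.order f) w); apply/all_pred1P/allP => y /mapP[x xw ->].
  by rewrite /= (order_cycle fw).
by rewrite [element_cycle_sizes _]/= perm_cat2l.
Qed.

(* Multiplying by the cyclic permutation along [w] turns permutations of the
   complement of [w] into permutations having [w] as a cycle. *)
Lemma card_ctype_fixed_cycle T (A : {set T}) (w : seq T) la :
  uniq w -> {subset w <= A} ->
  #|[set p : {perm T} | [&& perm_on A p, has_ctype p A (size w :: la)
                          & fcycle p w]]|
  = #|[set p : {perm T} | perm_on (A :\: [set x in w]) p
                        & has_ctype p (A :\: [set x in w]) la]|.
Proof.
move=> Uw wA; set B := A :\: _.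
have [c cE] := cycle_perm_exists Uw.
have c_on : perm_on [set x in w] c.
  by apply/subsetP => x; rewrite !inE cE; apply: contraR => /next_out ->.
have qcw (q : {perm T}) x : perm_on B q -> x \in w -> (q * c)%g x = next w x.
  by move=> qB xw; rewrite permM (out_perm qB) ?cE // !inE xw.
have qcB (q : {perm T}) x : perm_on B q -> x \in B -> (q * c)%g x = q x.
  move=> qB xB; rewrite permM cE next_out //.
  by have:= xB; rewrite -(perm_closed x qB) !inE => /andP[].
rewrite -[RHS](card_imset _ (mulIg c)); apply: eq_card => p.
apply/idP/imsetP => [|[q]]; rewrite !inE.
  case/and3P=> pA pt pw; exists (p * c^-1)%g; last by rewrite mulgKV.
  have onB : perm_on B (p * c^-1)%g.
    apply/subsetP => x; rewrite !inE permM => xN.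
    apply/andP; split.
      apply: contra xN => xw; apply/eqP; apply: (@perm_inj _ c).
      by rewrite permKV cE (nextE pw).
    apply: contraR xN => xA; rewrite (out_perm pA) //.
    apply/eqP/(@perm_inj _ c); rewrite permKV cE next_out //.
    by apply: contra xA => /wA.
  rewrite inE onB; move: pt; rewrite has_ctype_cons // -/B.
  rewrite (eq_has_ctype (g := (p * c^-1)%g)) // => x xB; last by rewrite perm_closed.
  by rewrite -{2}(mulgKV c p) qcB.
case/andP=> qB qt ->.
have qw : fcycle (q * c)%g w.
  by apply: cycle_from_next => // x xw; rewrite /= qcw.
rewrite qw andbT has_ctype_cons // -/B; apply/andP; split.
  apply: perm_onM; first by apply: subset_trans qB (subsetDl _ _).
  by apply: subset_trans c_on _; apply/subsetP => x; rewrite inE => /wA.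
rewrite (eq_has_ctype (g := q)) // => x xB; first by rewrite qcB.
by rewrite perm_closed.
Qed.

(** A word that is a cycle of [p] is the orbit of its first letter, listed from there. *)
Lemma card_fcycle_words T (p : {perm T}) (A : {set T}) l :
  perm_on A p -> 0 < l ->
  #|[set w : l.-tuple T | [&& all (mem A) w, uniq w & fcycle p w]]|
  = #|[set x in A | fingraph.order p x == l]|.
Proof.
move=> pA l_gt0; have homo_p : {homo p : x / x \in A}.
  by move=> x; rewrite perm_closed.
case: l l_gt0 => // l _.
rewrite -[LHS](@card_in_imset _ _ (fun w : l.+1.-tuple T => thead w)); last first.
  move=> w1 w2; rewrite !inE.
  case/tupleP: w1 => x w1; case/tupleP: w2 => y w2; rewrite !theadE.
  move=> /and3P[_ _ /fcycle_consE c1] /and3P[_ _ /fcycle_consE c2] exy.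
  by apply: val_inj; rewrite /= c1 c2 exy !size_tuple.
apply: eq_card => x; apply/imsetP/idP => [[w]|]; rewrite inE.
  case/tupleP: w => y w /and3P[/allP wA Uw cw]; rewrite theadE => ->.
  have yA : y \in A := wA y (mem_head _ _).
  rewrite inE yA /= (order_cycle cw) ?inE ?eqxx //=.
  by rewrite size_tuple.
case/andP=> xA /eqP ox.
have so : size (fingraph.orbit p x) == l.+1 by rewrite size_orbit ox.
exists (Tuple so); last by rewrite /thead (tnth_nth x) /= /fingraph.orbit ox.
rewrite inE /= orbit_uniq cycle_orbit ?andbT; last exact: perm_inj.
by apply/allP=> y /trajectP[i _ ->]; elim: i => //= i; apply: homo_p.
Qed.

(** Double counting of pairs of a permutation and a word [w] of length [l] forming one of its
    cycles. Each permutation has [l * m_l] such words; for each injective word, deleting its cycle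
    leaves the case of [la] on the complement, of size [#|A| - l]. *)
Lemma card_ctype T (A : {set T}) la :
  0 \notin la -> sumn la = #|A| ->
  #|[set p : {perm T} | perm_on A p & has_ctype p A la]| * zprod la = #|A|`!.
Proof.
elim: la A => [|l la IHla] A /=.
  move=> _ /esym/eqP; rewrite cards_eq0 => /eqP->; rewrite cards0 muln1.
  rewrite -[RHS](cards1 (1%g : {perm T})); apply: eq_card => p.
  rewrite !inE; apply/andP/eqP => [[p0 _]|->].
    by apply: perm_on_id p0 _; rewrite cards0.
  by rewrite perm_on1 /has_ctype enum_set0.
rewrite inE negb_or eq_sym -lt0n => /andP[l_gt0 la0] sA.
set P := [set p | _ & _].
have -> : #|P| * (l * (count_mem l la).+1 * zprod la) =
  (\sum_(p in P) #|[set w : l.-tuple T | [&& all (mem A) w, uniq w & fcycle p w]]|)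
   * zprod la.
  rewrite mulnA -sum_nat_const; congr (_ * _); apply: eq_bigr => p.
  rewrite inE => /andP[pA pt]; rewrite card_fcycle_words //.
  by rewrite (card_size_ctype l pt) /= eqxx.
under eq_bigr do rewrite -sum1dep_card.
rewrite (exchange_big_dep (fun w : l.-tuple T => all (mem A) w && uniq w)) /=; last first.
  by move=> p w _ /and3P[-> ->].
rewrite big_distrl /=.
rewrite (eq_bigr (fun=> (#|A| - l)`!)) => [|w /andP[wA Uw]]; last first.
  have cB : #|A :\: [set x in w]| = #|A| - l.
    rewrite cardsD; have /setIidPr-> : [set x in w] \subset A.
      by apply/subsetP => x; rewrite inE => /(allP wA).
    by rewrite cardsE (card_uniqP Uw) size_tuple.
  rewrite sum1dep_card -cB -IHla //; last by rewrite cB -sA addKn.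
  congr (_ * _); have wA' : {subset w <= A} by move=> x /(allP wA).
  rewrite -(card_ctype_fixed_cycle la Uw wA') size_tuple.
  by apply: eq_card => p; rewrite !inE wA Uw /= andbA.
rewrite sum_nat_cond_const card_uniq_tuples.
by rewrite ffact_fact // -sA leq_addr.
Qed.
End CycleTypes.

(** * Permutations shifting the blocks *)

Section CyclicBlocks.

Local Open Scope nat_scope.
Variables (k : nat) (V : finType) (c : V -> 'I_k).
Implicit Types (S : {set V}) (p q : {perm V}) (la : seq nat).

Definition slice S (i : 'I_k) := [set v in S | c v == i].

Definition shift_perms S :=
  [set p : {perm V} | perm_on S p & [forall v in S, c (p v) == ordS (c v)]].

Lemma perm_of_inj_in (T : finType) (f : T -> T) (A : {set T}) :
  {homo f : x / x \in A} -> {in A &, injective f} ->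
  {p : {perm T} | perm_on A p & {in A, p =1 f}}.
Proof.
move=> fA inj_f; pose g x := if x \in A then f x else x.
have inj_g : injective g.
  move=> x y; rewrite /g; case: ifP => xA; case: ifP => yA //.
  - exact: inj_f.
  - by move=> e; have := fA x xA; rewrite e yA.
  - by move=> e; have := fA y yA; rewrite -e xA.
exists (perm inj_g) => [|x xA]; last by rewrite permE /g xA.
by apply/subsetP => x; rewrite inE permE /g; case: ifP; rewrite ?eqxx.
Qed.

Lemma shift_permsP S p v :
  p \in shift_perms S -> v \in S -> p v \in S /\ c (p v) = ordS (c v).
Proof.
rewrite inE => /andP[pS /forall_inP h] vS.
by rewrite perm_closed //; split=> //; apply/eqP/h.
Qed.

(** With each slice enumerated by ['I_N], such a permutation is an independent choice, for every
    block, of an injection of ['I_N] into the next slice. *)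
Lemma card_shift_perms S N :
  (forall i, #|slice S i| = N) -> #|shift_perms S| = N`! ^ k.
Proof.
move=> cS; pose e i (j : 'I_N) := enum_val (cast_ord (esym (cS i)) j).
have e_in i j : e i j \in slice S i by apply: enum_valP.
have eS i j : e i j \in S by have := e_in i j; rewrite inE => /andP[].
have ec i j : c (e i j) = i by have := e_in i j; rewrite inE => /andP[_ /eqP].
have e_inj i : injective (e i) by move=> j j' /enum_val_inj/cast_ord_inj.
have e_surj v : v \in S -> exists j, e (c v) j = v.
  move=> vS; have vSi : v \in slice S (c v) by rewrite inE vS eqxx.
  exists (cast_ord (cS _) (enum_rank_in vSi v)).
  by rewrite /e cast_ordK enum_rankK_in.
pose J i := [set h : {ffun 'I_N -> V} in ffun_on (mem (slice S (ordS i)))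
              | injectiveb h].
have cJ i : #|J i| = N`!.
  by rewrite card_inj_ffuns_on card_ord cS ffactnn.
have -> : N`! ^ k = #|family (fun i => mem (J i))|.
  rewrite card_family foldrE big_image /= (eq_bigr _ (fun i _ => cJ i)).
  by rewrite prod_nat_const card_ord.
pose G p := [ffun i => [ffun j => p (e i j)]] : {ffun 'I_k -> {ffun 'I_N -> V}}.
rewrite -(@card_in_imset _ _ G); last first.
  move=> p q pQ qQ eG; apply/permP => v.
  case: (boolP (v \in S)) => vS.
    have [j <-] := e_surj v vS.
    by have /ffunP/(_ (c v)) := eG; rewrite !ffunE => /ffunP/(_ j); rewrite !ffunE.
  by move: pQ qQ; rewrite !inE => /andP[pS _] /andP[qS _]; rewrite !(out_perm _ vS).
apply: eq_card => g; apply/imsetP/familyP => [[p pQ ->] i|gJ].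
  have pe j : p (e i j) \in slice S (ordS i).
    by have [pS pc] := shift_permsP pQ (eS i j); rewrite inE pS pc ec eqxx.
  rewrite inE ffunE; apply/andP; split.
    by apply/ffun_onP => j; rewrite ffunE pe.
  by apply/injectiveP => j j'; rewrite !ffunE => /perm_inj/e_inj.
have g_in i j : g i j \in slice S (ordS i).
  by have := gJ i; rewrite inE => /andP[/ffun_onP/(_ j)].
have g_inj i : injective (g i).
  by have := gJ i; rewrite inE => /andP[_ /injectiveP].
(* The inverse direction: [f] is read off from the injections [g i]; the default [v] is taken only
   off [S]. *)
pose f v := if [pick j | e (c v) j == v] is Some j then g (c v) j else v.
have fe i j : f (e i j) = g i j.
  rewrite /f ec; case: pickP => [j' /eqP/e_inj->//|/(_ j)].
  by rewrite eqxx.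
have fS : {homo f : x / x \in S}.
  move=> v vS; have [j <-] := e_surj v vS; rewrite fe.
  by have := g_in (c v) j; rewrite inE => /andP[].
have f_inj : {in S &, injective f}.
  move=> v w vS wS; have [j <-] := e_surj v vS; have [j' <-] := e_surj w wS.
  rewrite !fe => eg.
  have := g_in (c v) j; have := g_in (c w) j'; rewrite -eg !inE.
  case/andP=> _ /eqP-> /andP[_ /eqP/ordS_inj eqc].
  by move: eg; rewrite eqc => /g_inj->.
have [p pS pE] := perm_of_inj_in fS f_inj.
exists p; last by apply/ffunP => i; apply/ffunP => j; rewrite !ffunE pE ?fe.
rewrite inE pS; apply/forall_inP => v vS; rewrite pE //.
have [j ej] := e_surj v vS; rewrite -{1}ej fe.
by have := g_in (c v) j; rewrite inE => /andP[_ /eqP->].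
Qed.

Lemma iter_shift S p v j :
  p \in shift_perms S -> v \in S ->
  iter j p v \in S /\ c (iter j p v) = iter j (@ordS k) (c v).
Proof.
move=> pQ vS; elim: j => [|j [jS jc]] //=.
by have [-> ->] := shift_permsP pQ jS; rewrite jc.
Qed.

Lemma iter_shift_slice S p i :
  p \in shift_perms S -> {homo iter k p : v / v \in slice S i}.
Proof.
move=> pQ v; rewrite inE => /andP[vS /eqP cv].
by have [vkS vkc] := iter_shift k pQ vS; rewrite inE vkS vkc cv iter_ordS eqxx.
Qed.

(* The return map to block [i] of [s * p], with [s] supported on that block,
   is [s] followed by the return map of [p]; averaging over [s] makes this
   return map equidistributed over the permutations of the block. *)
Lemma card_shift_ctype S N la i :
  0 \notin la -> sumn la = N -> (forall j, #|slice S j| = N) ->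
  #|[set p in shift_perms S | has_ctype (iter k p) (slice S i) la]| * zprod la
    = N`! ^ k.
Proof.
move=> la0 sla cS; set A := slice S i.
have AS : A \subset S by apply/subsetP => v; rewrite inE => /andP[].
set K := [set p in _ | _].
pose G := [set s : {perm V} | perm_on A s].
have cG : #|G| = N`!.
  by rewrite cardsE card_perm cS.
pose ok p := has_ctype (iter k p) A la.
have mulQ s p : s \in G -> (s * p \in shift_perms S)%g = (p \in shift_perms S).
  have mulQ1 s' p' : s' \in G -> p' \in shift_perms S -> (s' * p' \in shift_perms S)%g.
    rewrite inE => sA pQ; rewrite inE perm_onM //; last first.
    - by move: pQ; rewrite inE => /andP[].
    - exact: subset_trans sA AS.
    apply/forall_inP => v vS; rewrite permM.
    have svS : s' v \in S by rewrite (perm_closed v (subset_trans sA AS)).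
    have [_ ->] := shift_permsP pQ svS.
    case: (boolP (v \in A)) => vA; last by rewrite (out_perm sA).
    have := vA; have := vA; rewrite -{1}(perm_closed v sA) !inE.
    by case/andP=> _ /eqP-> /andP[_ /eqP->].
  move=> sG; apply/idP/idP; last exact: mulQ1.
  move/(mulQ1 s^-1%g); rewrite mulKg; apply; move: sG; rewrite !inE.
  exact: perm_onV.
have returnM s p : s \in G -> p \in shift_perms S -> {in A, forall x,
    iter k (s * p)%g x = iter k p (s x)}.
  rewrite inE => sA pQ x xA.
  have sxA : s x \in A by rewrite perm_closed.
  have sxS := subsetP AS _ sxA.
  (* The path starting at [s x] meets block [i] again only after [k] steps, and [s] fixes all other
     blocks, so [s] acts only at the start. *)
  have E j : j < k -> iter j.+1 (s * p)%g x = iter j.+1 p (s x).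
    elim: j => [|j IHj] ltj; first by rewrite /= permM.
    rewrite iterS IHj ?(ltnW ltj) // permM (out_perm sA) //.
    have [_] := iter_shift j.+1 pQ sxS; rewrite !inE => ->.
    move: sxA; rewrite inE => /andP[_ /eqP->].
    apply/nandP; right; apply/negP => /eqP/(congr1 val).
    rewrite iter_ordS_val => /eqP.
    rewrite -[X in _ == X](modn_small (ltn_ord i)) -[X in _ == X %[mod _]]addn0.
    by rewrite eqn_modDl mod0n modn_small.
  have k_gt0 : 0 < k by apply: leq_ltn_trans (ltn_ord i).
  by have := E k.-1; rewrite prednK // leqnn; apply.
(* On [A] the return map of [s * p] is [s * r], with [r] the return map of [p]. As [s] varies,
   [s * r] runs over all permutations supported on [A], so the count does not depend on [p]. *)
have cs p : p \in shift_perms S -> \sum_(s in G) ok (s * p)%g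
    = #|[set s : {perm V} | perm_on A s & has_ctype s A la]|.
  move=> pQ.
  have [r rA rE] : {r : {perm V} | perm_on A r & {in A, r =1 iter k p}}.
    apply: perm_of_inj_in; first exact: iter_shift_slice.
    by move=> x y _ _; rewrite -!permX => /perm_inj.
  rewrite -[RHS](card_imset _ (mulIg r^-1%g)) -sum1_card big_mkcond.
  rewrite [RHS]big_mkcond /=; apply: eq_bigr => s _.
  rewrite (can_imset_pre _ (mulgK r^-1%g)) invgK !inE.
  have -> : perm_on A (s * r)%g = perm_on A s.
    apply/idP/idP => sA; last exact: perm_onM.
    by rewrite -(mulgK r s) perm_onM ?perm_onV.
  case: ifP => //= sA.
  rewrite /ok (eq_has_ctype (g := (s * r)%g)) => [|x xA|x xA].
  - by case: has_ctype.
  - have sG : s \in G by rewrite inE.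
    by rewrite returnM // permM rE // perm_closed.
  - by rewrite permM !perm_closed.
(* In the other order of summation, left multiplication by [s] permutes the shift permutations, so
   every [s] contributes [#|K|]. *)
have : \sum_(p in shift_perms S) \sum_(s in G) ok (s * p)%g = N`! * #|K|.
  rewrite exchange_big /= -cG -sum_nat_const; apply: eq_bigr => s sG.
  rewrite (reindex_inj (mulgI s^-1%g)) /= -sum1_card big_mkcond [RHS]big_mkcond /=.
  apply: eq_bigr => p _; rewrite mulKVg mulQ; last by move: sG; rewrite !inE; apply: perm_onV.
  by rewrite !inE -/(ok p); case: ifP => //=; case: (ok p).
rewrite (eq_bigr _ cs) sum_nat_const (card_shift_perms cS) => E.
have N0 : 0 < N`! by rewrite fact_gt0.
apply/eqP; rewrite -(eqn_pmul2l N0) mulnA -E -mulnA.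
by rewrite card_ctype ?cS // mulnC.
Qed.

End CyclicBlocks.

(** * Forests as determinants *)

(** The Weinstein-Aronszajn (Sylvester) identity: both products in [E] equal the block matrix with
    rows [1, B] and [C, 1]. *)
Lemma det_1_sub_mulmxC (R : comNzRingType) m n (B : 'M[R]_(m, n)) (C : 'M[R]_(n, m)) :
  \det (1%:M - B *m C) = \det (1%:M - C *m B).
Proof.
have E : block_mx 1%:M B 0 1%:M *m block_mx (1%:M - B *m C) 0 C 1%:M
       = block_mx 1%:M 0 C 1%:M *m block_mx 1%:M B 0 (1%:M - C *m B).
  by rewrite !mulmx_block !mul1mx !mul0mx !mulmx1 !add0r !addr0 !subrK addrC subrK.
have := congr1 determinant E.
by rewrite !det_mulmx !det_lblock !det_ublock !det1 !mul1r !mulr1.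
Qed.

(* Multiplying by the unitriangular matrix of partial products
   [c_i c_(i+1) ... c_(j-1)] makes the matrix lower triangular. *)
Lemma det_cyclic_bidiagonal (F : comNzRingType) k (c : 'I_k -> F) :
  (0 < k)%N ->
  \det (\matrix_(i, j) ((i == j)%:R - c i *+ (j == ordS i))) = 1 - \prod_i c i.
Proof.
case: k c => // k c _; set M := \matrix_(_, _) _.
pose d n := c (inord n).
pose u (n m : nat) : F := if (n <= m)%N then \prod_(n <= l < m) d l else 0.
pose U : 'M[F]_k.+1 := \matrix_(i, j) u i j.
have detU : \det U = 1.
  rewrite -det_tr det_trig.
    by rewrite big1 // => i _; rewrite !mxE /u leqnn big_geq.
  by apply/is_trig_mxP => i j ltij; rewrite !mxE /u leqNgt ltij.
have MU i j : (M *m U) i j = u i j - c i * u (ordS i) j.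
  rewrite mxE.
  under eq_bigr => l _ do rewrite !mxE mulrBl !mulrnAl mul1r.
  rewrite sumrB; congr (_ - _).
    rewrite (bigD1 i) //= eqxx big1 ?addr0 // => l.
    by rewrite eq_sym => /negPf->.
  rewrite (bigD1 (ordS i)) //= eqxx big1 ?addr0 // => l /negPf->.
  by rewrite mulr0n.
rewrite -[LHS]mulr1 -[X in _ * X = _]detU -det_mulmx.
(* All rows but the last become unit vectors; the last one wraps around to column 0, and its
   diagonal entry carries the whole determinant. *)
have MUE i j : (M *m U) i j = if (i < k)%N then (i == j)%:R
                              else (i == j)%:R - c i * \prod_(0 <= l < j) d l.
  rewrite MU /u /=; case: ltnP => ik.
    rewrite modn_small //.
    have ci : c i = d i by rewrite /d inord_val.
    case: (ltngtP i j) => [ij|ji|eij].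
    - by rewrite [\prod_(_ <= _ < _) _]big_ltn // ci subrr -val_eqE /= ltn_eqF.
    - by rewrite mulr0 subr0 -val_eqE /= gtn_eqF.
    - by rewrite mulr0 subr0 big_geq ?eij // -val_eqE /= eij eqxx.
  have ei : i = k :> nat by apply/eqP; rewrite eqn_leq ik -ltnS ltn_ord.
  rewrite ei modnn leq0n -val_eqE /= ei.
  case: (ltngtP k j) => [kj|_|ekj]; first by have := ltn_ord j; rewrite ltnS leqNgt kj.
    by rewrite mulr0n.
  by rewrite -ekj big_geq.
rewrite det_trig; last first.
  apply/is_trig_mxP => i j ij; rewrite MUE -val_eqE /= (ltn_eqF ij).
  by rewrite (leq_trans ij) // -ltnS.
rewrite big_ord_recr /= big1 => [|i _]; last first.
  by rewrite MUE /= ltn_ord eqxx.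
rewrite MUE /= ltnn eqxx mul1r big_ord_recr /= mulrC; congr (_ - _ * _).
rewrite big_mkord; apply: eq_bigr => i _; congr c; apply: val_inj.
by rewrite /= inordK // ltnS ltnW.
Qed.

Section Forests.

Variables (F : fieldType) (V : finType) (S : {set V}).
Implicit Types (h : {ffun V -> V}) (a : V -> V -> F).

Definition absorbed (h : V -> V) := [forall v, [exists w in S, fconnect h v w]].

(** A forest with root set [S] is encoded by its parent map; fixing the roots makes the encoding by
    a map on all of [V] unique. *)
Definition rooted h := [forall v in S, h v == v] && absorbed h.

(** If every path reaches [S], a nonidentity permutation with nonzero term would contain a cycle of
    [h] avoiding [S], so only the identity contributes. Otherwise the indicator of the vertices that
    never reach [S] is a kernel vector. *)
Lemma det_functional_graph h :
  \det (\matrix_(i < #|V|, j < #|V|) ((i == j)%:R -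
     [&& enum_val i \notin S, enum_val j \notin S
       & h (enum_val i) == enum_val j]%:R : F)) = (absorbed h)%:R.
Proof.
set M := \matrix_(_, _) _; case: (boolP (absorbed h)) => [/forallP habs|].
  rewrite /determinant (bigD1 1%g) //= odd_perm1 expr0 mul1r.
  rewrite big1 => [|i _]; last first.
    rewrite perm1 mxE eqxx andbA andbb.
    case: (boolP (_ \notin S)) => [iS|_]; last by rewrite subr0.
    case: (h _ =P _) => [hi|_]; last by rewrite subr0.
    have /exists_inP[w wS] := habs (enum_val i).
    move/iter_findex; set n := findex _ _ _.
    have -> : iter n h (enum_val i) = enum_val i by elim: n => //= n ->.
    by move=> ew; rewrite ew wS in iS.
  rewrite big1 ?addr0 // => s s1.
  have [i si] : exists i, s i != i.
    apply/existsP; apply: contraR s1; rewrite negb_exists => /forallP fix_s.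
    by apply/eqP/permP => i; rewrite perm1; apply/eqP; rewrite -[_ == _]negbK fix_s.
  case: (\prod_i M i (s i) =P 0) => [->|/eqP/prodf_neq0 nz]; first by rewrite mulr0.
  have nzS j : s j != j -> enum_val j \notin S /\ h (enum_val j) = enum_val (s j).
    move=> sj; have := nz j isT; rewrite mxE [j == _]eq_sym (negPf sj) mulr0n sub0r oppr_eq0.
    by case: (boolP [&& _, _ & _]) => [/and3P[-> _ /eqP->]|]; rewrite ?eqxx.
  have it n : s (iter n s i) != iter n s i
              /\ iter n h (enum_val i) = enum_val (iter n s i).
    elim: n => //= n [sn ->]; split; first by rewrite (inj_eq perm_inj).
    by have [_ ->] := nzS _ sn.
  have /exists_inP[w wS /iter_findex] := habs (enum_val i).
  have [sn ->] := it (findex h (enum_val i) w) => ew.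
  by have [] := nzS _ sn; rewrite ew wS.
rewrite negb_forall => /existsP[v0 v0N].
pose U v := ~~ [exists w in S, fconnect h v w].
have US v : U v -> v \notin S.
  by apply: contra => vS; apply/exists_inP; exists v.
have Uh v : v \notin S -> U (h v) = U v.
  move=> vS; congr (~~ _); apply/exists_inP/exists_inP => -[w wS hw]; exists w => //.
    by apply: connect_trans hw; apply: fconnect1.
  by move: hw; rewrite fconnect_eqVf => /predU1P[evw|//]; rewrite evw wS in vS.
apply/eqP; rewrite -det_tr; apply/det0P.
exists (\row_j (U (enum_val j))%:R).
  apply/eqP => /rowP/(_ (enum_rank v0)); rewrite !mxE enum_rankK /U v0N.
  by move/eqP; rewrite oner_eq0.
apply/rowP => i; rewrite !mxE.
under eq_bigr => j _ do rewrite !mxE mulrBr.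
rewrite sumrB (bigD1 i) //= eqxx mulr1 big1 ?addr0 => [|j /negPf ji]; last first.
  by rewrite eq_sym ji mulr0.
set v := enum_val i; case: (boolP (v \in S)) => vS.
  rewrite /= [X in _ - X]big1 => [|j _]; last by rewrite mulr0.
  by rewrite subr0; case: (boolP (U v)) => // /US; rewrite vS.
rewrite /= (bigD1 (enum_rank (h v))) //= big1 ?addr0 => [|j jN]; last first.
  case: (h v =P _) => [ej|_]; last by rewrite andbF mulr0.
  by rewrite ej enum_valK eqxx in jN.
rewrite enum_rankK eqxx andbT Uh //.
case: (boolP (U v)) => Uv; rewrite ?mul0r ?mul1r ?subr0 //.
by rewrite US ?Uh // subrr.
Qed.

(* Expand each row of the right-hand matrix as a weighted sum over the choice
   of the image of the corresponding vertex. *)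
Lemma forest_sum_det a :
  \sum_(h : {ffun V -> V} | rooted h) \prod_(v | v \notin S) a v (h v) =
  \det (\matrix_(i < #|V|, j < #|V|)
    ((if enum_val i \in S then 1 else \sum_u a (enum_val i) u) *+ (i == j) -
     a (enum_val i) (enum_val j) *+
       ((enum_val i \notin S) && (enum_val j \notin S)))).
Proof.
(* On [S] the weight [b] vanishes unless [h] fixes the vertex, so summing over all maps imposes the
   root condition. *)
pose b v u := if v \in S then (u == v)%:R else a v u.
pose r (v w u : V) : F :=
  (v == w)%:R - [&& v \notin S, w \notin S & u == w]%:R.
set M := \matrix_(_, _) _.
have ME i j : M i j = \sum_u b (enum_val i) u * r (enum_val i) (enum_val j) u.
  rewrite mxE /b /r (inj_eq enum_val_inj); case: ifP => iS /=.
    rewrite (bigD1 (enum_val i)) //= eqxx mul1r subr0 big1 => [|u /negPf->].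
      by rewrite addr0.
    by rewrite mulr0n mul0r.
  under [RHS]eq_bigr do rewrite mulrBr.
  rewrite sumrB -big_distrl /= mulr_natr; congr (_ - _).
  case: (enum_val j \in S) => /=; first by rewrite big1 // => u _; rewrite mulr0.
  rewrite (bigD1 (enum_val j)) //= eqxx mulr1 big1 ?addr0 // => u /negPf->.
  by rewrite mulr0n mulr0.
rewrite /determinant.
under [RHS]eq_bigr => s _.
  under eq_bigr do rewrite ME.
  rewrite bigA_distr_bigA /= big_distrr /=.
  over.
rewrite exchange_big /=.
rewrite (reindex (fun h : {ffun V -> V} => [ffun i : 'I_#|V| => h (enum_val i)])) /=; last first.
  exists (fun g : {ffun 'I_#|V| -> V} => [ffun v => g (enum_rank v)]) => g _;
    by apply/ffunP => x; rewrite !ffunE ?enum_valK ?enum_rankK.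
rewrite big_mkcond; apply: eq_bigr => h _.
(* For a fixed [h] the signed sum over permutations is the weight of [h] times the determinant of
   its functional graph. *)
transitivity (\prod_(v : V) b v (h v) * (absorbed h)%:R).
  rewrite /rooted; case: (boolP (absorbed h)) => _; last by rewrite andbF mulr0.
  rewrite andbT mulr1 [RHS](bigID (mem S)) /=.
  rewrite [X in _ = _ * X](eq_bigr (fun v => a v (h v))) => [|v vS]; last by rewrite /b ifN.
  rewrite [X in _ = X * _](eq_bigr (fun v => (h v == v)%:R)) => [|v vS]; last by rewrite /b ifT.
  case: (boolP [forall v in S, _]) => [/forall_inP hS|].
    by rewrite [X in _ = X * _]big1 ?mul1r // => v /hS->.
  rewrite negb_forall_in => /exists_inP[v vS /negPf hv].
  by rewrite [X in _ = X * _](bigD1 v) //= hv mulr0n !mul0r.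
rewrite -det_functional_graph /determinant big_distrr /=; apply: eq_bigr => s _.
rewrite mulrCA; congr (_ * _); under [RHS]eq_bigr do rewrite ffunE.
rewrite big_split /=; congr (_ * _).
  rewrite (reindex (@enum_val V predT)) /=; last first.
    by exists enum_rank => x _; rewrite ?enum_valK ?enum_rankK.
  by apply: eq_bigr.
by apply: eq_bigr => i _; rewrite mxE /r (inj_eq enum_val_inj).
Qed.

End Forests.

(** * Forests whose edges lead from each block to the next *)

Section CyclicForests.

Variables (F : fieldType) (k : nat) (V : finType) (c : V -> 'I_k) (y : V -> F).

Definition block_sum (A : {set V}) (i : 'I_k) : F := \sum_(v in A | c v == i) y v.

Definition shift_weight (v w : V) : F := y w *+ (c w == ordS (c v)).

Lemma shift_weight_sum v : \sum_w shift_weight v w = block_sum setT (ordS (c v)).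
Proof.
rewrite /block_sum [RHS]big_mkcond; apply: eq_bigr => w _.
by rewrite inE /shift_weight mulrb.
Qed.

Lemma forest_sum_cyclic (S : {set V}) :
  (0 < k)%N -> (forall i, block_sum setT i != 0) ->
  \sum_(h : {ffun V -> V} | rooted S h) \prod_(v | v \notin S) shift_weight v (h v)
  = (\prod_(v | v \notin S) block_sum setT (ordS (c v))) *
    (1 - \prod_i (block_sum (~: S) i / block_sum setT i)).
Proof.
move=> k_gt0 e_neq0; set e := block_sum setT; set u := block_sum (~: S).
rewrite forest_sum_det; set M := \matrix_(_, _) _.
pose d v := if v \in S then 1 else e (ordS (c v)).
pose D : 'M[F]_#|V| := diag_mx (\row_j d (enum_val j)).
(* The edge part factors through the blocks: [B] records the block of the source, [C] the weight of
   the target. The inverse in [B] compensates for the diagonal factor [D] pulled out in front. *)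
pose B : 'M[F]_(#|V|, k) :=
  \matrix_(i, j) ((e (ordS j))^-1 *+ ((enum_val i \notin S) && (c (enum_val i) == j))).
pose C : 'M[F]_(k, #|V|) :=
  \matrix_(j, i) (y (enum_val i) *+ ((enum_val i \notin S) && (c (enum_val i) == ordS j))).
have -> : M = D *m (1%:M - B *m C).
  apply/matrixP => i j; rewrite mul_diag_mx !mxE shift_weight_sum -/(d _) mulrBr.
  congr (_ - _); first by rewrite mulr_natr.
  under eq_bigr do rewrite !mxE.
  case: (boolP (enum_val i \in S)) => iS /=.
    by rewrite big1 ?mulr0 // => l _; rewrite mulr0n mul0r.
  rewrite (bigD1 (c (enum_val i))) //= eqxx big1 => [|l]; last first.
    by rewrite eq_sym => /negPf->; rewrite mulr0n mul0r.
  rewrite addr0 mulr1n /d (negPf iS) mulVKf // /shift_weight -mulrnA.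
  by rewrite mulnb andbC.
rewrite det_mulmx det_1_sub_mulmxC det_diag; congr (_ * _).
  rewrite [RHS]big_mkcond.
  rewrite [RHS](reindex (@enum_val V predT)) /=; last first.
    by exists enum_rank => x _; rewrite ?enum_valK ?enum_rankK.
  by apply: eq_bigr => i _; rewrite mxE /d; case: ifP.
have -> : 1%:M - C *m B =
    \matrix_(i, j) ((i == j)%:R - u (ordS i) / e (ordS (ordS i)) *+ (j == ordS i)).
  apply/matrixP => i j; rewrite !mxE; congr (_ - _).
  case: (j =P ordS i) => [->|/eqP ji] /=.
    rewrite mulr1n /u /block_sum big_distrl [RHS]big_mkcond /=.
    rewrite [RHS](reindex (@enum_val V predT)) /=; last first.
      by exists enum_rank => x _; rewrite ?enum_valK ?enum_rankK.
    apply: eq_bigr => l _; rewrite !mxE inE.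
    by case: ifP => _; rewrite ?mulr1n ?mulr0n ?mul0r.
  rewrite mulr0n big1 // => l _; rewrite !mxE.
  case: (c (enum_val l) =P j) => [->|_]; last by rewrite andbF mulr0n mulr0.
  by rewrite (negPf ji) andbF mulr0n mul0r.
rewrite det_cyclic_bidiagonal //; congr (_ - _).
(* The numerators are shifted by one block and the denominators by two; both shifts disappear in a
   product over the whole cycle. *)
rewrite !prodf_div; congr (_ / _).
  by rewrite [RHS](reindex_inj (@ordS_inj k)).
by rewrite [RHS](reindex_inj (@ordS_inj k)) [RHS](reindex_inj (@ordS_inj k)).
Qed.

End CyclicForests.

(** * Sums over subsets *)

Section ElementarySums.

Variables (R : comNzRingType) (V : finType).
Implicit Types (U A : {set V}).

Definition esum (y : V -> R) (j : nat) (U : {set V}) : R :=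
  \sum_(A : {set V} | (A \subset U) && (#|A| == j)) \prod_(v in A) y v.

(** Pairs of an [N]-set [A] and a point [v] outside it are pairs of an [N.+1]-set [B = v |: A] and a
    marked point of [B]; each [B] has [N.+1] markings. *)
Lemma sum_esumS (y : V -> R) N U :
  \sum_(A : {set V} | (A \subset U) && (#|A| == N))
     (\prod_(v in A) y v * \sum_(v in U :\: A) y v) = N.+1%:R * esum y N.+1 U.
Proof.
transitivity (\sum_v \sum_(A : {set V} | [&& A \subset U, #|A| == N & v \in U :\: A])
    (\prod_(w in A) y w * y v)).
  rewrite (exchange_big_dep (fun A : {set V} => (A \subset U) && (#|A| == N))) /=.
    by apply: eq_bigr => A /andP[AU cA]; rewrite big_distrr AU cA.
  by move=> v A _ /and3P[-> ->].
transitivity (\sum_v \sum_(B : {set V} | [&& B \subset U, #|B| == N.+1 & v \in B])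
    \prod_(w in B) y w).
  apply: eq_bigr => v _.
  rewrite [RHS](reindex_onto (fun A => v |: A) (fun B => B :\ v)) /=; last first.
    by move=> B /and3P[_ _ vB]; rewrite setD1K.
  apply: eq_big => [A|A /and3P[_ _ /setDP[_ vA]]]; last first.
    by rewrite big_setU1 //= mulrC.
  rewrite setU11 andbT subUset sub1set inE.
  case: (boolP (v \in A)) => vA /=.
    rewrite !andbF; apply/esym/negbTE; apply: contraL vA => /andP[_ /eqP<-].
    by rewrite setD11.
  by rewrite setU1K // eqxx andbT cardsU1 vA add1n eqSS; case: (v \in U); rewrite ?andbT ?andbF.
rewrite (exchange_big_dep (fun B : {set V} => (B \subset U) && (#|B| == N.+1))) /=.
  rewrite big_distrr; apply: eq_bigr => B /andP[BU cB] /=.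
  by rewrite BU cB sumr_const (eqP cB) mulr_natl.
by move=> v B _ /and3P[-> ->].
Qed.

Lemma esum1 y U : esum y 1 U = \sum_(v in U) y v.
Proof.
have := sum_esumS y 0 U; rewrite mul1r => <-.
rewrite (big_pred1 set0) ?big_set0 ?mul1r ?setD0 // => A.
by rewrite cards_eq0 /=; case: (A =P set0) => [->|_]; rewrite ?sub0set ?andbF.
Qed.

(** A set is determined by its slices, which may be chosen independently, so the sum distributes
    over the product. *)
Lemma sum_balanced_prod k (c : V -> 'I_k) N (phi : 'I_k -> {set V} -> R) :
  \sum_(S : {set V} | [forall i, #|slice c S i| == N]) \prod_i phi i (slice c S i)
  = \prod_i \sum_(A : {set V} | (A \subset slice c setT i) && (#|A| == N)) phi i A.
Proof.
rewrite bigA_distr_big_dep.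
rewrite [RHS](reindex_onto (fun S => [ffun i => slice c S i])
  (fun g : {ffun 'I_k -> {set V}} => [set v | v \in g (c v)])) /=; last first.
  move=> g /familyP gP; apply/ffunP => i; apply/setP => v; rewrite ffunE !inE.
  have := gP i; rewrite unfold_in => /andP[/subsetP gi _].
  apply/andP/idP => [[vg /eqP<- //]|vg].
  by have := gi v vg; rewrite !inE => /eqP ->.
apply: eq_big => [S|S _]; last by apply: eq_bigr => i _; rewrite ffunE.
rewrite [X in _ && X](_ : _ = true) ?andbT; last first.
  by apply/eqP/setP => v; rewrite inE ffunE !inE eqxx andbT.
apply/forallP/familyP => H i; have := H i; rewrite ffunE unfold_in.
  by move=> ->; rewrite andbT; apply/subsetP => v; rewrite !inE => /andP[].
by case/andP.
Qed.

End ElementarySums.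

(** * Splitting a map at its periodic points *)

Section RecurrentPart.

Variable (V : finType).
Implicit Types (S : {set V}) (f h : {ffun V -> V}) (s : {perm V}).

(** The periodic points. The path starts at [f v] because [fconnect f v v] always holds. *)
Definition recurrent (f : V -> V) : {set V} := [set v | fconnect f (f v) v].

Lemma recurrent_closed (f : V -> V) : {homo f : v / v \in recurrent f}.
Proof.
move=> v; rewrite !inE fconnect_eqVf => /predU1P[fv|ffv]; first by rewrite !fv connect0.
exact: connect_trans ffv (fconnect1 f v).
Qed.

Lemma recurrent_sym (f : V -> V) v w :
  v \in recurrent f -> fconnect f v w -> fconnect f w v.
Proof.
rewrite inE fconnect_f => fv.
have inv x y : fconnect f x y = (y \in fingraph.orbit f x) := fconnect_orbit f x y.
rewrite !inv => wv; have vv : v \in fingraph.orbit f v by rewrite -inv; apply: connect0.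
by rewrite (in_orbit_cycle fv).
Qed.

Lemma recurrent_inj (f : V -> V) : {in recurrent f &, injective f}.
Proof.
move=> v w vR wR efvw.
have wv : fconnect f v w.
  apply: connect_trans (fconnect1 f v) _; rewrite efvw.
  by move: wR; rewrite inE.
move: vR; rewrite inE fconnect_f => /inj_cycle; apply=> //.
  by rewrite -fconnect_orbit; apply: connect0.
by rewrite -fconnect_orbit.
Qed.

Lemma recurrent_absorbed (f : V -> V) : absorbed (recurrent f) f.
Proof.
apply/forallP => v; have /trajectP[i lti ei] := looping_order f v.
apply/exists_inP; exists (iter i f v); last exact: fconnect_iter.
rewrite inE -iterS -ei -(subnK lti) iterD.
exact: fconnect_iter.
Qed.

(** Only the part of a path before its first visit to [S] matters, and there the two maps agree. *)
Lemma absorbed_eq S (f g : V -> V) :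
  {in [predC S], f =1 g} -> absorbed S f -> absorbed S g.
Proof.
move=> fg /forallP fS; apply/forallP => v.
have /exists_inP[w wS /iter_findex] := fS v; move: (findex f v w) => n.
elim: n v => [|n IHn] v /=.
  by move=> ->; apply/exists_inP; exists w; rewrite ?connect0.
rewrite -iterS iterSr; case: (boolP (v \in S)) => vS.
  by move=> _; apply/exists_inP; exists v; rewrite ?connect0.
move/IHn => /exists_inP[w' w'S fw']; apply/exists_inP; exists w' => //.
by apply: connect_trans fw'; rewrite fg // fconnect1.
Qed.

(** [f] permutes the finite set [S], so its points are periodic. Conversely a periodic point reaches
    [S], can return from there, and [S] is closed. *)
Lemma recurrentE S (f : V -> V) :
  {homo f : v / v \in S} -> {in S &, injective f} -> absorbed S f ->
  recurrent f = S.
Proof.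
move=> fS f_inj /forallP f_abs.
have fwS v w : v \in S -> fconnect f v w -> w \in S.
  by move=> vS /iter_findex<-; elim: (findex f v w) => //= n; apply: fS.
apply/setP => v; apply/idP/idP => [vR|vS].
  have /exists_inP[w wS vw] := f_abs v.
  exact: fwS wS (recurrent_sym vR vw).
have [p pS pE] := perm_of_inj_in fS f_inj.
have pf x n : x \in S -> iter n p x = iter n f x /\ iter n p x \in S.
  by move=> xS; elim: n => //= n [<- nS]; rewrite perm_closed // pE.
rewrite inE; have : fconnect p (p v) v by rewrite fconnect_sym ?fconnect1 //; apply: perm_inj.
rewrite (pE v vS) => /iter_findex; move: (findex _ _ _) => n E.
rewrite -[X in fconnect f _ X]E (pf _ n (fS v vS)).1.
exact: fconnect_iter.
Qed.

Definition join S s h : {ffun V -> V} := [ffun v => if v \in S then s v else h v].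

Lemma join_recurrent S s h :
  perm_on S s -> absorbed S h -> recurrent (join S s h) = S.
Proof.
move=> sS hS; apply: recurrentE.
- by move=> v vS; rewrite ffunE vS perm_closed.
- by move=> v w vS wS; rewrite !ffunE vS wS => /perm_inj.
- apply: absorbed_eq hS => v; rewrite inE /= => /negPf vS.
  by rewrite ffunE vS.
Qed.

(** The maps with periodic set [S] correspond bijectively to pairs of a permutation supported on [S]
    and a forest rooted at [S]. *)
Lemma sum_by_recurrent (R : nmodType) (Phi : {ffun V -> V} -> R) :
  \sum_f Phi f =
  \sum_(S : {set V}) \sum_(s : {perm V} | perm_on S s) \sum_(h | rooted S h)
     Phi (join S s h).
Proof.
rewrite (partition_big (fun f : {ffun V -> V} => recurrent f) predT) //=.
apply: eq_bigr => S _; rewrite pair_big /=.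
(* [sig] extracts the permutation of the periodic points, extended by the identity; [out] turns
   these points into roots. The default [1] does not occur when [recurrent f = S]. *)
pose sig f := odflt 1%g [pick s : {perm V} | perm_on S s && [forall v in S, s v == f v]].
pose out f := [ffun v => if v \in S then v else f v] : {ffun V -> V}.
have sigP f : recurrent f = S -> perm_on S (sig f) /\ {in S, sig f =1 f}.
  move=> fS; rewrite /sig; case: pickP => [s /andP[sS /forall_inP sf]|].
    by split=> // v vS; apply/eqP/sf.
  have f_S : {homo f : v / v \in S} by rewrite -fS; apply: recurrent_closed.
  have f_inj : {in S &, injective f} by rewrite -fS; apply: recurrent_inj.
  have [s sS sE] := perm_of_inj_in f_S f_inj.
  move/(_ s); rewrite sS => /negbT/negP; case.
  by apply/forall_inP => v vS; rewrite sE.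
rewrite (reindex_onto (fun p : {perm V} * {ffun V -> V} => join S p.1 p.2)
                      (fun f => (sig f, out f))) /=; last first.
  move=> f /eqP fS; apply/ffunP => v; rewrite !ffunE.
  case: ifP => vS; last by rewrite vS.
  by have [_ sE] := sigP f fS; apply: sE.
apply: eq_bigl => -[s h] /=; apply/andP/andP => [[/eqP fS /eqP[es eh]]|[sS /andP[hS h_abs]]].
  have [sS sE] := sigP _ fS; split; first by rewrite -es.
  apply/andP; split.
    by apply/forall_inP => v vS; rewrite -eh ffunE vS.
  have := recurrent_absorbed (join S s h); rewrite fS; apply: absorbed_eq.
  by move=> v; rewrite inE /= => /negPf vS; rewrite ffunE vS.
have fS := join_recurrent sS h_abs; split; first exact/eqP.
have [s'S s'E] := sigP _ fS; apply/eqP; congr (_, _).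
  apply/permP => v; case: (boolP (v \in S)) => vS; last by rewrite !(out_perm _ vS).
  by rewrite s'E // ffunE vS.
apply/ffunP => v; rewrite !ffunE; case: ifP => vS; last by rewrite vS.
by have /forall_inP/(_ v vS)/eqP := hS.
Qed.

End RecurrentPart.

(** * Weighted enumeration of block-shifting maps with prescribed cycle type *)

Section WeightedEnumeration.

Variables (F : fieldType) (k : nat) (V : finType) (c : V -> 'I_k) (y : V -> F).
Variables (i0 : 'I_k) (N : nat) (la : seq nat).
Hypotheses (la0 : 0%N \notin la) (sum_la : sumn la = N).
Hypothesis e_neq0 : forall i, block_sum c y setT i != 0.

Notation block := (slice c setT).
Notation e := (block_sum c y setT).

(** Only block [i0] is constrained: if [f] shifts the blocks, all slices of its periodic set have
    the same size. *)
Definition has_cyclic_type (f : V -> V) :=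
  (#|slice c (recurrent f) i0| == N) &&
  has_ctype (iter k f) (slice c (recurrent f) i0) la.

(** [p] injects every slice into the next one; going round the cycle forces equality. *)
Lemma card_slice_shift (S : {set V}) (p : {perm V}) i j :
  p \in shift_perms c S -> #|slice c S i| = #|slice c S j|.
Proof.
move=> pQ; have leS l : (#|slice c S l| <= #|slice c S (ordS l)|)%N.
  rewrite -(card_imset _ (@perm_inj _ p)); apply/subset_leq_card/subsetP => w.
  case/imsetP=> v; rewrite inE => /andP[vS /eqP cv] ->.
  by have [pS pc] := shift_permsP pQ vS; rewrite inE pS pc cv eqxx.
have le_all l l' : (#|slice c S l| <= #|slice c S l'|)%N.
  (* Adding [k] keeps the natural subtraction from truncating. *)
  have -> : l' = iter (l' + k - l) (@ordS k) l.
    apply: val_inj; rewrite iter_ordS_val subnKC.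
      by rewrite modnDr modn_small.
    by rewrite (leq_trans (ltnW (ltn_ord l))) // leq_addl.
  by elim: (l' + k - l)%N => //= n IHn; apply: leq_trans IHn (leS _).
by apply/eqP; rewrite eqn_leq !le_all.
Qed.

Lemma prod_shift_weight_perm (S : {set V}) (s : {perm V}) :
  perm_on S s ->
  \prod_(v in S) shift_weight c y v (s v)
    = (\prod_(v in S) y v) *+ (s \in shift_perms c S).
Proof.
move=> sS; rewrite inE sS /=; case: (boolP [forall v in S, _]) => [/forall_inP h|].
  rewrite [RHS](reindex_inj (@perm_inj _ s)) /=.
  apply: eq_big => v; first by rewrite perm_closed.
  by move=> vS; rewrite /shift_weight h.
rewrite negb_forall_in => /exists_inP[v vS /negPf hv].
by rewrite (bigD1 v) //= /shift_weight hv mulr0n mul0r.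
Qed.

Lemma weighted_sum_by_recurrent :
  (zprod la)%:R *
    (\sum_(f : {ffun V -> V} | has_cyclic_type f) \prod_v shift_weight c y v (f v))
  = (N`! ^ k)%N%:R *
    \sum_(S : {set V} | [forall i, #|slice c S i| == N])
      (\prod_(v in S) y v) *
      (\prod_(v | v \notin S) e (ordS (c v)) *
       (1 - \prod_i (block_sum c y (~: S) i / e i))).
Proof.
have k_gt0 : (0 < k)%N by apply: leq_ltn_trans (ltn_ord i0).
rewrite big_mkcond sum_by_recurrent /= !big_distrr [RHS]big_mkcond /=.
apply: eq_bigr => S _.
rewrite -(forest_sum_cyclic S k_gt0 e_neq0).
set T := \sum_(h | rooted S h) _.
(* The cycle type condition involves only [S] and [s], so the forest sum [T] factors out. *)
have E (s : {perm V}) : perm_on S s ->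
  \sum_(h | rooted S h) (if has_cyclic_type (join S s h)
       then \prod_v shift_weight c y v (join S s h v) else 0) =
  ((\prod_(v in S) y v) * T) *+
    [&& #|slice c S i0| == N, s \in shift_perms c S
      & has_ctype (iter k s) (slice c S i0) la].
  move=> sS; rewrite /T big_distrr -sumrMnl /=; apply: eq_bigr => h /andP[_ h_abs].
  rewrite /has_cyclic_type (join_recurrent sS h_abs).
  have -> : \prod_v shift_weight c y v (join S s h v) =
    (\prod_(v in S) y v * \prod_(v | v \notin S) shift_weight c y v (h v))
      *+ (s \in shift_perms c S).
    rewrite (bigID (mem S)) /= -mulrnAl -prod_shift_weight_perm //.
    congr (_ * _); apply: eq_bigr => v vS; rewrite ffunE ?vS //.
    by rewrite (negPf vS).
  case: (#|slice c S i0| == N) => //=.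
  case: (boolP (s \in shift_perms c S)) => sQ /=; last by rewrite mulr0n if_same.
  rewrite mulr1n (eq_has_ctype (g := iter k s)) ?mulrb //; last exact: iter_shift_slice.
  move=> v; rewrite inE => /andP[vS _].
  elim: (k) => //= n <-; rewrite [RHS]ffunE ifT //.
  by have [] := iter_shift n sQ vS.
rewrite (eq_bigr _ E) sumrMnr.
(* If one slice has [N] points and a shift permutation exists, all slices have [N] points; hence
   unbalanced sets contribute nothing. *)
rewrite (_ : (\sum_(s : {perm V} | perm_on S s) _)%N = if [forall i, #|slice c S i| == N]
    then #|[set s in shift_perms c S | has_ctype (iter k s) (slice c S i0) la]|
    else 0%N); last first.
  case: ifPn => [/forallP bal|nbal].
    rewrite -[RHS]sum1_card big_mkcond [RHS]big_mkcond /=; apply: eq_bigr => s _.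
    by rewrite bal !inE; case: (perm_on S s) => //=; case: (_ && _).
  rewrite big1 // => s sS; apply/eqP; rewrite eqb0; apply: contra nbal.
  case/and3P=> /eqP c0 sQ _; apply/forallP => i.
  by rewrite (card_slice_shift i i0 sQ) c0.
case: ifPn => [/forallP bal|_]; last by rewrite mulr0n mulr0.
rewrite -[X in _ * X = _]mulr_natl mulrA -natrM mulnC (card_shift_ctype i0 la0 sum_la) //.
by move=> i; apply/eqP.
Qed.

Lemma weighted_enumeration :
  (zprod la)%:R *
    (\sum_(f : {ffun V -> V} | has_cyclic_type f) \prod_v shift_weight c y v (f v))
  = (N`! ^ k)%N%:R *
    (\prod_i (e i ^ (#|block (ord_pred i)|%:Z - N.+1%:Z))) *
    (\prod_i (esum y 1 (block i) * esum y N (block i))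
     - N.+1%:R ^+ k * \prod_i esum y N.+1 (block i)).
Proof.
rewrite weighted_sum_by_recurrent -mulrA; congr (_ * _).
set G := \prod_i e i ^ _.
have eE i : esum y 1 (block i) = e i.
  by rewrite esum1; apply: eq_bigl => v; rewrite !inE.
have prod_e_neq0 : \prod_i e i != 0 by apply/prodf_neq0 => i _.
(* Each of the [n_(i-1) - N] points of block [i-1] off [S] contributes [e i]. One factor [e i] per
   block is split off to clear the denominators of the forest factor, whence the exponent with
   [N.+1]. *)
have out_weight (S : {set V}) : [forall i, #|slice c S i| == N] ->
    \prod_(v | v \notin S) e (ordS (c v)) = G * \prod_i e i.
  move/forallP => bal; rewrite (partition_big c predT) //= -big_split /=.
  rewrite [RHS](reindex_inj (@ordS_inj k)); apply: eq_bigr => i _ /=.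
  rewrite (eq_bigr (fun=> e (ordS i))) => [|v /andP[_ /eqP->] //].
  rewrite prodr_const -[X in _ * X]expr1z -expfzDr // ordSK [LHS]exprnP; congr (_ ^ _).
  have -> : #|block i| = (#|[pred v | (v \notin S) && (c v == i)]| + N)%N.
    rewrite -(eqP (bal i)) -(cardsID S) addnC; congr (_ + _)%N; apply: eq_card => v.
      by rewrite !inE; case: (v \in S).
    by rewrite !inE andbC.
  by rewrite PoszD -addn1 PoszD opprD addrA !addrK.
have prod_slices (S : {set V}) :
    \prod_(v in S) y v = \prod_i \prod_(v in slice c S i) y v.
  rewrite (partition_big c predT) //=; apply: eq_bigr => i _.
  by apply: eq_bigl => v; rewrite inE.
transitivity (\sum_(S : {set V} | [forall i, #|slice c S i| == N])
    G * (\prod_i (e i * \prod_(v in slice c S i) y v) -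
         \prod_i (\prod_(v in slice c S i) y v *
                  \sum_(v in block i :\: slice c S i) y v))).
  apply: eq_bigr => S balS; rewrite out_weight // !big_split /= -prod_slices.
  rewrite -mulrA mulrCA; congr (_ * _).
  rewrite prodfV [X in _ * X = _]mulrBr mulr1 [X in _ - X]mulrCA mulfV // mulr1 mulrBr.
  rewrite mulrC; congr (_ - _ * _); apply: eq_bigr => i _; apply: eq_bigl => v.
  by rewrite !inE; case: (v \in S); case: (c v == i).
rewrite -big_distrr /= sumrB; congr (_ * (_ - _)).
  rewrite (sum_balanced_prod c N (fun i A => e i * \prod_(v in A) y v)).
  by apply: eq_bigr => i _; rewrite -big_distrr eE.
rewrite (sum_balanced_prod c N (fun i A => \prod_(v in A) y v * \sum_(v in block i :\: A) y v)).
rewrite (eq_bigr (fun i => N.+1%:R * esum y N.+1 (block i))) => [|i _]; last exact: sum_esumS.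
by rewrite big_split /= prodr_const card_ord.
Qed.

End WeightedEnumeration.

(** * From the maps [f_i] to a single map *)

Section ReturnMap.

Local Open Scope nat_scope.

(** Every trajectory meets the periodic set in fewer than [#|V|] steps and never leaves it. *)
Lemma recurrent_iter (V : finType) (g : V -> V) n v :
  #|V| <= n -> iter n g v \in recurrent g.
Proof.
move=> le_n; have /forallP/(_ v)/exists_inP[w wR vw] := recurrent_absorbed g.
have lt_i : findex g v w < n.
  by apply: leq_trans (findex_max vw) (leq_trans (max_card _) le_n).
rewrite -(subnK (ltnW lt_i)) iterD iter_findex //.
by elim: (n - _) => //= j; apply: recurrent_closed.
Qed.

Lemma card_porbit_order (T : finType) (s : {perm T}) x :
  #|porbit s x| = fingraph.order s x.
Proof.
apply: eq_card => z; apply/porbitP/idP => [[n ->]|/iter_findex<-].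
  by rewrite permX inE fconnect_iter.
by exists (findex s x z); rewrite permX.
Qed.

Lemma card_porbits_size (T : finType) (s : {perm T}) l :
  l * #|[set C in porbits s | #|C| == l]| = #|[set x | fingraph.order s x == l]|.
Proof.
rewrite -[RHS]sum1_card (partition_big (porbit s) (mem [set C in porbits s | #|C| == l])) /=.
  rewrite mulnC -sum_nat_const; apply: eq_bigr => C; rewrite inE => /andP[/imsetP[x _ ->] /eqP cx].
  rewrite -[LHS]cx -[LHS]sum1_card; apply: eq_bigl => z.
  rewrite inE -card_porbit_order eq_porbit_mem.
  case: (boolP (z \in porbit s x)); rewrite ?andbF // -eq_porbit_mem => /eqP->.
  by rewrite cx eqxx.
by move=> x; rewrite !inE card_porbit_order => ->; rewrite imset_f.
Qed.

Lemma has_ctype_porbits (T : finType) (s : {perm T}) la :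
  0 \notin la -> sumn la = #|T| ->
  has_ctype s setT la <->
  (forall l, 1 <= l <= #|T| -> #|[set C in porbits s | #|C| == l]| = count_mem l la).
Proof.
move=> la0 sla; split=> [st l /andP[l_gt0 _]|cl].
  apply/eqP; rewrite -(eqn_pmul2l l_gt0) card_porbits_size -(card_size_ctype l st).
  by apply/eqP/eq_card => x; rewrite !inE.
(* [perm_eq] compares only the counts of values occurring in one of the two lists, and these all lie
   between 1 and [#|T|]. *)
apply/allP => l; rewrite mem_cat => l_in /=.
have l_bd : 1 <= l <= #|T|.
  case/orP: l_in => [/mapP[x _ ->]|/flattenP[_ /mapP[a a_la ->]]].
    by rewrite fingraph.order_gt0 max_card.
  rewrite mem_nseq => /andP[a_gt0 /eqP->]; rewrite a_gt0 -sla /=.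
  by elim: (la) a_la => //= b s' IHs; rewrite inE => /predU1P[<-|/IHs/leq_trans->//];
    rewrite ?leq_addr ?leq_addl.
rewrite count_element_cycle_sizes -cl // card_porbits_size count_map -size_filter.
rewrite -(card_uniqP (filter_uniq _ (enum_uniq _))); apply/eqP/eq_card => x.
by rewrite mem_filter mem_enum !inE andbT.
Qed.

(** The permutation of the subtype can only be the restriction of [G], and [i] carries its orbits to
    orbits of [g]. *)
Lemma acts_with_cycle_typeE (T V : finType) (G : T -> T) (g : V -> V) (i : T -> V)
    (S : {set T}) la :
  injective i -> (forall x, i (G x) = g (i x)) -> {homo G : x / x \in S} ->
  {in S &, injective G} -> 0 \notin la -> sumn la = #|S| ->
  acts_with_cycle_type G S la <-> has_ctype g (i @: S) la.
Proof.
move=> i_inj iG GS G_inj la0 sla.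
have cS : #|{: {x | x \in S}}| = #|S| by rewrite card_sig; apply: eq_card.
have E (s : {perm {x | x \in S}}) : (forall x, val (s x) = G (val x)) ->
    has_ctype g (i @: S) la = has_ctype s setT la.
  move=> sG; pose j (x : {x | x \in S}) := i (val x).
  rewrite (perm_has_ctype _ _ (s := [seq j x | x <- enum {: {x | x \in S}}])).
  - rewrite /has_ctype -map_comp enum_setT -enumT; congr (perm_eq _ _).
    apply: eq_map => x /=; apply: (@order_transport _ _ j predT) => //.
      by move=> ? ? /i_inj/val_inj.
    by move=> z _; rewrite /j sG.
  - by rewrite map_inj_uniq ?enum_uniq // => ? ? /i_inj/val_inj.
  - move=> v; apply/mapP/imsetP => [[x _ ->]|[x xS ->]].
      by exists (val x) => //; apply: valP.
    by exists (exist _ x xS); rewrite ?mem_enum.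
split=> [[s [sG cl]]|gt].
  by rewrite (E s sG); apply/has_ctype_porbits; rewrite ?cS.
pose sf (x : {x | x \in S}) : {x | x \in S} := exist _ (G (val x)) (GS _ (valP x)).
have sf_inj : injective sf.
  move=> x z /(congr1 val)/= eG; apply: val_inj.
  by apply: G_inj; rewrite ?(valP x) ?(valP z).
have sG x : val (perm sf_inj x) = G (val x) by rewrite permE.
exists (perm sf_inj); split=> // l; rewrite -cS.
by apply: (has_ctype_porbits _ _ _).1; rewrite ?cS // -(E _ sG).
Qed.

End ReturnMap.

Section CyclicMaps.

Variables (k : nat) (X : 'I_k -> finType).
Implicit Types (f : maps X).

Notation V := (dunion X).
Notation c := (@tag 'I_k X : V -> 'I_k).

Definition total_map f : {ffun V -> V} :=
  [ffun v : V => Tagged X (f (tag v) (tagged v))].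

Lemma Tagged_inj i : injective (Tagged X : X i -> V).
Proof. by move=> x z e; apply: eq_from_Tagged e. Qed.

Lemma Tagged_full_comp f i (x : X i) :
  Tagged X (full_comp f x) = iter k (total_map f) (Tagged X x).
Proof.
have E j : Tagged X (partial_comp f j x) = iter j (total_map f) (Tagged X x).
  by elim: j => //= j <-; rewrite ffunE.
have castE l m (e : l = m) (z : X l) : Tagged X (ecast j (X j) e z) = Tagged X z.
  by case: m / e.
by rewrite -E /full_comp castE.
Qed.

Lemma total_map_inj : injective total_map.
Proof.
move=> f f' /ffunP eF; apply/ffunP => i; apply/ffunP => x.
by have := eF (Tagged X x); rewrite !ffunE => e; apply: eq_from_Tagged e.
Qed.

Lemma total_map_surj (g : {ffun V -> V}) :
  (forall v, c (g v) = ordS (c v)) -> exists f, g = total_map f.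
Proof.
move=> gc; have /fin_all_exists[z zP] (v : V) : exists z : X (ordS (tag v)), g v = Tagged X z.
  by exists (etagged (gc v)); rewrite etaggedK.
exists [ffun i => [ffun x => z (Tagged X x)]].
by apply/ffunP => -[i x]; rewrite !ffunE zP.
Qed.

(** The return map [G] is the [k]-th iterate of the glued map [g]. Its stable image is the set [S]
    of points of block [i] that are periodic under [g], reached after at most [#|V|] iterations. *)
Lemma eventually_cyclic_mapE f i N la :
  (0 < k)%N -> 0%N \notin la -> sumn la = N ->
  eventually_cyclic_map (@full_comp k X f i) N la <->
  has_cyclic_type c i N la (total_map f).
Proof.
move=> k_gt0 la0 sla; set g := total_map f; set G := @full_comp k X f i.
pose S := [set x : X i | Tagged X x \in recurrent g].
have SE x : (x \in S) = (Tagged X x \in recurrent g) by rewrite inE.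
have iG n x : Tagged X (iter n G x) = iter (n * k) g (Tagged X x).
  by elim: n => //= n IHn; rewrite Tagged_full_comp IHn mulSn iterD.
have imS : Tagged X @: S = slice c (recurrent g) i.
  apply/setP => -[j x]; rewrite inE; apply/imsetP/andP => [[z zS ->]|[xR /= /eqP ej]].
    by move: zS; rewrite SE => ->.
  by subst j; exists x; rewrite ?SE.
have closed n v : v \in recurrent g -> iter n g v \in recurrent g.
  by move=> vR; elim: n => //= n; apply: recurrent_closed.
have GS n : {homo iter n G : x / x \in S}.
  by move=> x; rewrite !SE iG; apply: closed.
have G_inj n : {in S &, injective (iter n G)}.
  move=> x z; rewrite !SE => xR zR /(congr1 (Tagged X)); rewrite !iG => e.
  apply: Tagged_inj; elim: (n * k)%N e => //= m IHm /recurrent_inj e.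
  by apply: IHm; apply: e; apply: closed.
have stable n : (#|{: V}| <= n)%N -> iter n G @: setT = S.
  move=> le_n; apply/eqP; rewrite eqEsubset; apply/andP; split.
    apply/subsetP => _ /imsetP[x _ ->]; rewrite SE iG recurrent_iter //.
    by rewrite (leq_trans le_n) // leq_pmulr.
  have /eqP<- : iter n G @: S == S.
    rewrite eqEcard (card_in_imset (G_inj n)) leqnn andbT.
    by apply/subsetP => _ /imsetP[x xS ->]; apply: GS.
  exact/imsetS/subsetT.
have cS : #|slice c (recurrent g) i| = #|S|.
  by rewrite -imS card_imset //; apply: Tagged_inj.
have actsE : sumn la = #|S| ->
    acts_with_cycle_type G S la <-> has_ctype (iter k g) (slice c (recurrent g) i) la.
  move=> cSla; rewrite -imS; apply: acts_with_cycle_typeE => //.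
  - exact: Tagged_inj.
  - exact: Tagged_full_comp.
  - exact: (GS 1%N).
  - exact: (G_inj 1%N).
rewrite /has_cyclic_type cS; split=> [[S' [[M SM] cS' act]]|/andP[/eqP cSN ct]].
  have eS : S' = S.
    by rewrite -(SM (M + #|{: V}|)%N (leq_addr _ _)) stable ?leq_addl.
  move: cS' act; rewrite eS => cS'; rewrite cS' eqxx => act.
  by apply/actsE; rewrite // cS'.
exists S; split=> //; first by exists #|{: V}|.
by apply/actsE; rewrite // cSN.
Qed.

(** Maps that do not shift the blocks have weight 0, and the remaining ones are exactly the glued
    maps [total_map f]. *)
Lemma sum_EC_total (hk : (0 < k)%N) (F : fieldType) (y : V -> F) N la :
  0%N \notin la -> sumn la = N ->
  \sum_(f in EC hk X N la) \prod_(i < k) \prod_(v : X i) y (Tagged X (f i v)) =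
  \sum_(g : {ffun V -> V} | has_cyclic_type c (Ordinal hk) N la g)
     \prod_v shift_weight c y v (g v).
Proof.
move=> la0 sla; pose shifts (g : {ffun V -> V}) := [forall v, c (g v) == ordS (c v)].
rewrite [RHS](bigID shifts) /= [X in _ + X]big1 ?addr0; last first.
  move=> g /andP[_]; rewrite negb_forall => /existsP[v /negPf gv].
  by rewrite (bigD1 v) //= /shift_weight gv mulr0n mul0r.
rewrite (eq_bigl (mem (total_map @: EC hk X N la))) => [|g]; last first.
  apply/andP/imsetP => [[gt /forallP gc]|[f fE ->]].
    have [|f eg] := @total_map_surj g; first by move=> v; apply/eqP.
    exists f; last exact: eg.
    rewrite inE; apply/asboolP/(eventually_cyclic_mapE f (Ordinal hk) hk la0 sla).
    by rewrite -eg.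
  split; last by apply/forallP => v; rewrite ffunE.
  apply/(eventually_cyclic_mapE f (Ordinal hk) hk la0 sla).
  by move: fE; rewrite inE => /asboolP.
rewrite big_imset /=; last by move=> f f' _ _; apply: total_map_inj.
apply: eq_bigr => f _; rewrite sig_big_dep /=; apply: eq_bigr => v _.
by rewrite /shift_weight ffunE /= eqxx mulr1n.
Qed.

End CyclicMaps.

(** * The polynomial formula and the cardinality formula *)

Lemma zlambdaE N la : is_partition N la -> zlambda N la = zprod la.
Proof.
case/and3P=> _ la0 /eqP sla; rewrite /zlambda.
have {sla} : all (fun l => 1 <= l < N.+1)%N la.
  apply/allP => l l_la; rewrite lt0n ltnS (memPn la0) //= -sla.
  elim: (la) l_la => //= b s IHs; rewrite inE => /predU1P[<-|/IHs/leq_trans->//];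
    by rewrite ?leq_addr ?leq_addl.
elim: la {la0} => [_|l la IHla /= /andP[/andP[l_gt0 l_leN] /IHla {}IHla]].
  by rewrite big1 // => l _; rewrite expn0.
rewrite -IHla !(big_mkcond xpredT) /=.
(* Adding a part [l] raises its multiplicity from [m] to [m + 1], which multiplies only the factor
   of [l], by [l * (m + 1)]. *)
rewrite (bigD1_seq l) ?mem_index_iota ?l_gt0 ?iota_uniq //=.
rewrite [in RHS](bigD1_seq l) ?mem_index_iota ?l_gt0 ?iota_uniq //=.
rewrite eqxx add1n expnS factS (eq_bigr (fun i => i ^ count_mem i la * (count_mem i la)`!)%N).
  by rewrite -!mulnA; congr (_ * _)%N; rewrite mulnCA; congr (_ * _)%N; rewrite mulnCA.
by move=> i /negPf; rewrite eq_sym => ->.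
Qed.

Lemma esum_map (R R' : comNzRingType) (phi : {rmorphism R -> R'}) (V : finType)
    (y : V -> R) j U : phi (esum y j U) = esum (phi \o y) j U.
Proof.
by rewrite rmorph_sum; apply: eq_bigr => A _; rewrite rmorph_prod.
Qed.

Lemma esum_const1 (R : comNzRingType) (V : finType) j (U : {set V}) :
  esum (fun=> 1 : R) j U = 'C(#|U|, j)%:R.
Proof.
rewrite -cards_draws -sum1_card natr_sum; apply: eq_big => [A|A _].
  by rewrite inE.
by rewrite big1.
Qed.

Section Formula.

Variables (k : nat) (X : 'I_k -> finType).

Notation V := (dunion X).
Notation c := (@tag 'I_k X : V -> 'I_k).

Lemma slice_part i : slice c setT i = part X i.
Proof. by apply/setP => v; rewrite !inE. Qed.

Lemma card_part i : #|part X i| = #|X i|.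
Proof.
rewrite -[RHS](card_imset _ (@Tagged_inj _ X i)); apply: eq_card => -[j x].
rewrite inE /=; apply/eqP/imsetP => [ej|[z _ /(congr1 tag)//]].
by subst j; exists x.
Qed.

Lemma weighted_EC_formula (hk : (0 < k)%N) (F : fieldType) (y : V -> F) N la :
  0%N \notin la -> sumn la = N -> (forall i, esum y 1 (part X i) != 0) ->
  (zprod la)%:R *
    (\sum_(f in EC hk X N la) \prod_(i < k) \prod_(v : X i) y (Tagged X (f i v))) =
  (N`! ^ k)%N%:R *
    (\prod_i (esum y 1 (part X i) ^ (#|X (ord_pred i)|%:Z - N.+1%:Z))) *
    (\prod_i (esum y 1 (part X i) * esum y N (part X i))
     - N.+1%:R ^+ k * \prod_i esum y N.+1 (part X i)).
Proof.
move=> la0 sla e_neq0.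
have eE i : block_sum c y setT i = esum y 1 (part X i).
  by rewrite esum1; apply: eq_bigl => v; rewrite !inE.
rewrite (sum_EC_total hk y la0 sla) (weighted_enumeration (Ordinal hk) la0 sla).
  congr (_ * _ * (_ - _ * _)); apply: eq_bigr => i _.
  - by rewrite eE slice_part card_part.
  - by rewrite slice_part.
  - by rewrite slice_part.
by move=> i; rewrite eE.
Qed.

End Formula.

Lemma zprod_gt0 la : 0%N \notin la -> (0 < zprod la)%N.
Proof.
elim: la => //= l la IHla; rewrite inE negb_or eq_sym -lt0n => /andP[l_gt0 /IHla z_gt0].
by rewrite !muln_gt0 l_gt0 z_gt0.
Qed.

Lemma vpoly_natr_neq0 (V : finType) n : (0 < n)%N -> (n%:R : vpoly V) != 0.
Proof.
move=> n_gt0; rewrite -(rmorph_nat (@mpolyC #|V| rat)) mpolyC_eq0.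
by rewrite Num.Theory.pnatr_eq0 -lt0n.
Qed.

(** Evaluation at the all-ones point gives [#|U|], which is nonzero in [rat]. *)
Lemma elem_sym1_neq0 (V : finType) (U : {set V}) :
  (0 < #|U|)%N -> elem_sym 1 U != 0.
Proof.
move=> U_gt0; have -> : elem_sym 1 U = esum (@var V) 1 U by [].
apply/eqP => /(congr1 (meval (fun=> 1 : rat))).
rewrite (esum_map (meval (fun=> 1))) meval0.
have -> : esum (meval (fun=> 1 : rat) \o @var V) 1 U = esum (fun=> 1) 1 U.
  by apply: eq_bigr => A _; apply: eq_bigr => v _; rewrite /= mevalXU.
by rewrite esum_const1 bin1 => /eqP; rewrite Num.Theory.pnatr_eq0 -leqn0 leqNgt U_gt0.
Qed.

Theorem proposition5p2 (k N : nat) (hk : (0 < k)%N) (hN : (0 < N)%N)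
    (la : seq nat) (hla : is_partition N la)
    (X : 'I_k -> finType) (hX : forall i : 'I_k, (0 < #|X i|)%N) :
  (tofrac (Plambda hk X N la) : ratfun (dunion X)) =
    ((N`! ^ k)%N%:R / (zlambda N la)%:R) *
    (\prod_(i < k)
       elem_symF 1 (part X i) ^ (#|X (ord_pred i)|%:Z - (N.+1)%:Z)) *
    (\prod_(j < k) (elem_symF 1 (part X j) * elem_symF N (part X j)) -
     (N.+1)%:R ^+ k * \prod_(j < k) elem_symF N.+1 (part X j))
  /\
  (#|EC hk X N la|%:R : rat) =
    ((zlambda N la)%:R)^-1 *
    (\prod_(i < k)
       ((#|X i|%:R : rat) ^ (#|X (ord_pred i)|%:Z - (N.+1)%:Z) *
        (#|X i| ^_ N)%:R)) *
    (\prod_(j < k) #|X j|%:R - \prod_(j < k) (#|X j|%:R - N%:R)).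
Proof.
have /and3P[_ la0 /eqP sla] := hla.
rewrite (zlambdaE hla); set z := zprod la.
have z_gt0 : (0 < z)%N by apply: zprod_gt0.
split.
  (* First formula: the weights are the variables, viewed in the fraction field so that the block
     sums are invertible. *)
  pose y v : ratfun (dunion X) := tofrac (var v).
  have esumE j i : elem_symF j (part X i) = esum y j (part X i).
    exact: (esum_map (@tofrac _) (@var _)).
  have z_neq0 : (z%:R : ratfun (dunion X)) != 0.
    by rewrite -(rmorph_nat (@tofrac _)) tofrac_eq0 vpoly_natr_neq0.
  have e_neq0 i : esum y 1 (part X i) != 0.
    by rewrite -esumE tofrac_eq0 elem_sym1_neq0 // card_part.
  have PE : tofrac (Plambda hk X N la) =
      \sum_(f in EC hk X N la) \prod_(i < k) \prod_(v : X i) y (Tagged X (f i v)).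
    rewrite rmorph_sum; apply: eq_bigr => f _; rewrite rmorph_prod.
    by apply: eq_bigr => i _; rewrite rmorph_prod.
  apply: (mulfI z_neq0); rewrite PE (weighted_EC_formula hk la0 sla e_neq0).
  rewrite [RHS]mulrA [z%:R * (_ * _)]mulrA [z%:R * (_ / _)]mulrC divfK //.
  by congr (_ * _ * (_ - _ * _)); apply: eq_bigr => i _; rewrite !esumE.
(* Second formula: all weights are 1, so [esum] becomes a binomial coefficient and the block sums
   become the cardinalities [n_i]. *)
have e_neq0 i : esum (fun=> 1 : rat) 1 (part X i) != 0.
  by rewrite esum_const1 bin1 card_part Num.Theory.pnatr_eq0 -lt0n.
have z_neq0 : (z%:R : rat) != 0 by rewrite Num.Theory.pnatr_eq0 -lt0n.
have cardE : (#|EC hk X N la|%:R : rat) =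
    \sum_(f in EC hk X N la) \prod_(i < k) \prod_(v : X i) (fun=> 1) (Tagged X (f i v)).
  rewrite -sumr_const; apply: eq_bigr => f _.
  by apply/esym/big1 => i _; apply: big1.
apply: (mulfI z_neq0); rewrite cardE (weighted_EC_formula hk la0 sla e_neq0).
rewrite !mulrA mulfV // mul1r.
rewrite [X in _ * X * _ = _](eq_bigr (fun i =>
    (#|X i|%:R : rat) ^ (#|X (ord_pred i)|%:Z - N.+1%:Z))); last first.
  by move=> i _; rewrite esum_const1 bin1 card_part.
have binE (n m : nat) : m`!%:R * 'C(n, m)%:R = (n ^_ m)%:R :> rat.
  by rewrite -natrM mulnC bin_ffact.
(* For [n < N] the difference [n - N] in [rat] is negative, unlike the truncated one, but the
   falling factorial in front of it is 0. *)
have ffactE (n : nat) : N`!%:R * (N.+1%:R * 'C(n, N.+1)%:R) = (n ^_ N)%:R * (n%:R - N%:R) :> rat.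
  rewrite mulrA -natrM mulnC -factS binE ffactnSr natrM.
  case: (leqP N n) => [leNn|ltnN]; first by rewrite natrB.
  by rewrite ffact_small // !mul0r.
rewrite [in RHS]big_split /= -!mulrA mulrCA; congr (_ * _).
(* The [k]-th powers are spread over the blocks, one [N!] and one [N.+1] each, to turn binomials
   into falling factorials. *)
have NkE : (N`! ^ k)%N%:R = \prod_(i < k) N`!%:R :> rat.
  by rewrite natrX prodr_const card_ord.
have Nk1E : N.+1%:R ^+ k = \prod_(i < k) N.+1%:R :> rat.
  by rewrite prodr_const card_ord.
rewrite NkE Nk1E !mulrBr -!big_split /=; congr (_ - _); apply: eq_bigr => i _.
  by rewrite !esum_const1 card_part bin1 mulrCA mulrC binE.
by rewrite esum_const1 card_part ffactE.
Qed.
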